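(* If $G$ is a simple series-parallel graph, then $\chi'_{gl}(G)\leq \Delta(G)+1$. In particular, every $K_4$-minor-free graph $G$ is edge-$(\Delta(G)+1)$-group choosable.
   Context: All graphs are finite and simple; $\Delta(G)$ is the maximum degree of $G$. A graph is called series-parallel if it has no subgraph isomorphic to a subdivision of $K_4$. $\ell(G)$ denotes the line graph of $G$ (its vertices are the edges of $G$, two being adjacent iff they share an endpoint in $G$). Let $H$ be a graph with a fixed orientation of its edges, $A$ an Abelian group, $L:V(H)\to 2^A$ a list assignment and $f:E(H)\to A$. An $(A,L,f)$-coloring of $H$ is a map $c:V(H)\to A$ with $c(v)\in L(v)$ for every vertex $v$ and $c(x)-c(y)\neq f(xy)$ for every edge $xy$ directed from $x$ to $y$. $H$ is $(A,L)$-colorable if it has an $(A,L,f)$-coloring for every $f:E(H)\to A$ (this does not depend on the orientation). $H$ is $k$-group choosable if it is $(A,L)$-colorable for every Abelian group $A$ of order at least $k$ and every $L$ with $|L(v)|=k$ for all $v\in V(H)$. $\chi_{gl}(H)$ is the smallest $k$ such that $H$ is $k$-group choosable. $G$ is edge-$k$-group choosable if $\ell(G)$ is $k$-group choosable, and $\chi'_{gl}(G)=\chi_{gl}(\ell(G))$. *)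

(* Defs.v *)
From HB Require Import structures.
From mathcomp Require Import all_boot all_order all_algebra.
From mathcomp Require Import boolp classical_sets functions cardinality.

Set Implicit Arguments.
Unset Strict Implicit.
Unset Printing Implicit Defensive.

Record sgraph := SGraph {
  vertex :> finType;
  adj : rel vertex;
  adj_sym : symmetric adj;
  adj_irr : irreflexive adj }.

Definition degree (G : sgraph) (v : G) : nat := #|[pred w | adj v w]|.

Definition max_degree (G : sgraph) : nat := \max_(v : G) degree v.

Definition is_edge (G : sgraph) (e : {set G}) : bool :=
  [exists x : G, exists y : G, adj x y && (e == [set x; y]%SET)].

Definition edge (G : sgraph) : finType := {e : {set G} | is_edge e}.

Definition line_adj (G : sgraph) : rel (edge G) :=
  fun e1 e2 => (e1 != e2) && (val e1 :&: val e2 != finset.set0)%SET.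

Lemma line_adj_sym (G : sgraph) : symmetric (@line_adj G).
Proof. by move=> e1 e2; rewrite /line_adj eq_sym finset.setIC. Qed.

Lemma line_adj_irr (G : sgraph) : irreflexive (@line_adj G).
Proof. by move=> e; rewrite /line_adj eqxx. Qed.

Definition line_graph (G : sgraph) : sgraph :=
  SGraph (@line_adj_sym G) (@line_adj_irr G).

Definition complete_adj (n : nat) : rel 'I_n := fun i j => i != j.

Lemma complete_adj_sym n : symmetric (@complete_adj n).
Proof. by move=> i j; rewrite /complete_adj eq_sym. Qed.

Lemma complete_adj_irr n : irreflexive (@complete_adj n).
Proof. by move=> i; rewrite /complete_adj eqxx. Qed.

Definition complete_graph (n : nat) : sgraph :=
  SGraph (@complete_adj_sym n) (@complete_adj_irr n).

(* Up to isomorphism: S embeds as a (not necessarily induced) subgraph of G. *)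
Definition subgraph_of (S G : sgraph) : Prop :=
  exists g : S -> G,
    injective g /\ (forall u v : S, adj u v -> adj (g u) (g v)).

(* S arises from H by replacing each edge xy with a path from b x to b y whose
   list of inner vertices is p x y; distinct edges receive internally disjoint
   paths, inner vertices are not branch vertices, and S has no further vertex
   or edge. *)
Definition is_subdivision (H S : sgraph) : Prop :=
  exists (b : H -> S) (p : H -> H -> seq S),
    [/\ injective b,
        (forall x y : H, adj x y ->
           [/\ path (@adj S) (b x) (rcons (p x y) (b y)),
               uniq (p x y),
               (forall z : H, b z \notin p x y)
             & p y x = rev (p x y)]),
        (forall (x y x' y' : H) (w : S), adj x y -> adj x' y' ->
           w \in p x y -> w \in p x' y' -> [set x; y]%SET = [set x'; y']%SET),
        (forall w : S, (exists x, w = b x) \/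
           (exists x y : H, adj x y /\ w \in p x y))
      & (forall u v : S, adj u v ->
           exists x y : H, adj x y /\
             infix [:: u; v] (b x :: rcons (p x y) (b y)))].

Definition series_parallel (G : sgraph) : Prop :=
  ~ exists S : sgraph, is_subdivision (complete_graph 4) S /\ subgraph_of S G.

Definition connected_set (G : sgraph) (B : {set G}) : Prop :=
  B != finset.set0 /\
  forall u v : G, u \in B -> v \in B ->
    connect [rel x y : G | [&& x \in B, y \in B & adj x y]] u v.

Definition is_minor (H G : sgraph) : Prop :=
  exists B : H -> {set G},
    [/\ (forall x : H, connected_set (B x)),
        (forall x y : H, x != y -> [disjoint B x & B y])
      & (forall x y : H, adj x y ->
           exists u v : G, [/\ u \in B x, v \in B y & adj u v])].

Definition K4_minor_free (G : sgraph) : Prop := ~ is_minor (complete_graph 4) G.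

(* D x y means that the edge xy is directed from x to y. *)
Definition orientation (H : sgraph) (D : rel H) : Prop :=
  (forall x y : H, D x y -> adj x y) /\
  (forall x y : H, adj x y -> D x y (+) D y x).

Definition group_coloring (H : sgraph) (D : rel H) (A : zmodType)
    (L : H -> set A) (f : edge H -> A) (c : H -> A) : Prop :=
  (forall v : H, L v (c v)) /\
  (forall (e : edge H) (x y : H),
     val e = [set x; y]%SET -> D x y -> (c x - c y)%R <> f e).

(* The orientation is immaterial: reversing an edge amounts to negating f on
   it. It is quantified universally here. *)
Definition group_colorable (H : sgraph) (A : zmodType) (L : H -> set A) : Prop :=
  forall D : rel H, orientation D ->
  forall f : edge H -> A, exists c : H -> A, group_coloring D L f c.

Definition group_choosable (k : nat) (H : sgraph) : Prop :=
  forall A : zmodType, (`I_k #<= [set: A])%classic%card ->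
  forall L : H -> set A, (forall v : H, (L v #= `I_k)%classic%card) ->
  group_colorable L.

Lemma card_eq_notin (A : choiceType) (X : set A) (n : nat) (t : seq A) :
  (X #= `I_n)%classic%card -> size t < n -> exists2 a, X a & a \notin t.
Proof.
move=> Xn tn; apply: contrapT => nex.
have finX : finite_set X by apply/finite_setP; exists n.
have := @uniq_leq_size A (finmap.enum_fset (fset_set X)) t.
rewrite (card_fset_set Xn) leqNgt tn => /(_ (finmap.fset_uniq _)) h.
suff : false by []; apply: h => a; rewrite in_fset_set // => /set_mem Xa.
by apply: contrapT => /negP at_; apply: nex; exists a.
Qed.

Lemma group_choosable_card (H : sgraph) : group_choosable #|H| H.
Proof.
move=> A _ L LH D [Dadj Dasym] f.
suff [c [cL cf]] : exists c : H -> A, (forall v, v \in enum H -> L v (c v)) /\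
    (forall (e : edge H) x y, x \in enum H -> y \in enum H ->
       val e = [set x; y]%SET -> D x y -> (c x - c y)%R <> f e).
  exists c; split=> [v|e x y ve dxy]; first by apply: cL; rewrite mem_enum.
  by apply: cf => //; rewrite mem_enum.
have : size (enum H) <= #|H| by rewrite -cardE.
have := enum_uniq H.
elim: (enum H) => [|v s IH] /=; first by move=> _ _; exists (fun=> 0%R).
case/andP=> vs us szs; have [c [cL cf]] := IH us (ltnW szs).
pose fe (u : H) : A := oapp f 0%R (insub [set v; u]%SET).
pose g u := (if D v u then c u + fe u else c u - fe u)%R.
have [a La at_] := card_eq_notin (t := [seq g u | u <- s]) (LH v)
  ltac:(by rewrite size_map).
have feE (e : edge H) u : val e = [set v; u]%SET -> fe u = f e.
  by rewrite /fe => <-; rewrite valK.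
have neq u : u \in s -> u == v = false.
  by move=> us'; apply/negP => /eqP uv; rewrite -uv us' in vs.
exists (fun u => if u == v then a else c u); split=> [w|e x y].
  rewrite inE; have [->//|_ /=] := eqVneq w v; exact: cL.
rewrite !inE; have [->|xv] := eqVneq x v; have [->|yv] := eqVneq y v => //=.
- by move=> _ _ _ /Dadj; rewrite adj_irr.
- move=> _ ys ve dvy h; case/negP: at_; apply/mapP; exists y => //.
  by rewrite /g dvy (feE e) // -h GRing.addrC GRing.subrK.
- move=> xs _ ve dxv h; case/negP: at_; apply/mapP; exists x => //.
  have := Dasym _ _ (Dadj _ _ dxv); rewrite dxv /g => /negbTE ->.
  by rewrite (feE e) ?ve 1?finset.setUC // -h GRing.opprB GRing.addrC GRing.subrK.
- exact: cf.
Qed.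

Lemma ex_group_choosable (H : sgraph) : exists k, `[< group_choosable k H >].
Proof. by exists #|H|; apply/asboolP; exact: group_choosable_card. Qed.

Definition chi_gl (H : sgraph) : nat := ex_minn (ex_group_choosable H).

Definition edge_group_choosable (k : nat) (G : sgraph) : Prop :=
  group_choosable k (line_graph G).

Definition chi'_gl (G : sgraph) : nat := chi_gl (line_graph G).

(* Main.v *)
Require Import Defs.
From mathcomp Require Import all_boot.
From mathcomp Require Import all_algebra zify.
From mathcomp Require Import boolp classical_sets cardinality.

(** A line graph inherits sparseness from the degrees of [G]: an edge [xy] of a
    subgraph meets [d x + d y - 2] other edges of it, which is at most the
    maximum degree as soon as [d x <= 2].  So it is enough that every subgraph
    with an edge has a vertex of degree one or two.  Then every nonempty set of
    vertices of the line graph contains one with at most [max_degree G]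
    neighbours in the set ([line_graph_degenerate]), and a greedy choice along
    the resulting elimination order always finds a free colour in lists of size
    [max_degree G + 1], whatever the group and the labels
    ([degenerate_group_choosable]).

    The sparseness of series-parallel graphs is a theorem of Dirac: a graph with
    an edge in which every non-isolated vertex has degree at least three
    contains a subdivision of [K_4] ([dirac_K4_subdivision]).  The proof takes a
    longest path [P], written [A ++ c :: B], whose first vertex [a] is adjacent
    to [c], with [A] of size at least two and as short as possible.  All
    neighbours of [a] lie on [P].  By minimality of [A], none of them is in [A]
    except the successor of [a], so a third neighbour [x] lies in [B].  Reversing
    [A] gives a path [rev A ++ c :: B] of the same kind, so the last vertex [d]
    of [A] also has a neighbour [y] in [B].  If [x] precedes [y], then [a], [d],
    [c], [x] are the branch vertices of a subdivided [K_4]: the path [P] supplies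
    the connections [a .. d], [d c] and [c .. x], the edges [a c] and [a x] two
    more, and the last one goes from [d] to [y] and back along [P] to [x].  If
    [y] precedes [x], exchange the roles of [a] and [d].

    For the second claim, a subdivision of [K_4] in [G] gives a [K_4] minor
    ([subdivision_minor]), hence [K_4]-minor-free graphs are series-parallel. *)

Set Implicit Arguments.
Unset Strict Implicit.
Unset Printing Implicit Defensive.

(** * Greedy colouring of degenerate graphs *)

Definition degenerate (k : nat) (H : sgraph) : Prop :=
  forall F : {set H}, F != finset.set0 ->
  exists2 v, v \in F & #|[set u in F | adj v u]%SET| <= k.

(** Colour the vertices in the reverse of a degeneracy order: each of the at most
    [k] neighbours already coloured forbids exactly one value, so a list of
    size [k + 1] still offers one. *)
Lemma degenerate_group_choosable k (H : sgraph) :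
  degenerate k H -> group_choosable k.+1 H.
Proof.
move=> degH A _ L LH D [Dadj Dasym] f.
suff [c [cL cf]] : exists c : H -> A,
    (forall v, v \in [set: H]%SET -> L v (c v)) /\
    (forall (e : edge H) x y, x \in [set: H]%SET -> y \in [set: H]%SET ->
       val e = [set x; y]%SET -> D x y -> (c x - c y)%R <> f e).
  exists c; split=> [v|e x y]; first by apply: cL; rewrite finset.in_setT.
  by apply: cf; rewrite finset.in_setT.
have [n] := ubnP #|[set: H]%SET|.
elim: n [set: H]%SET => // n IH F; rewrite ltnS => szF.
have [->|F0] := eqVneq F finset.set0.
  by exists (fun=> 0%R); split=> [v|e x y]; rewrite finset.inE.
have [v vF degv] := degH F F0.
have [|c [cL cf]] := IH (F :\ v)%SET.
  by apply: leq_trans szF; rewrite [X in _ < X](cardsD1 v) vF.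
(* [g u] is the one value at [v] that the colour of a neighbour [u] forbids;
   the default 0 in [fe] only concerns pairs that are not edges. *)
pose fe (u : H) : A := oapp f 0%R (insub [set v; u]%SET).
pose g u := (if D v u then c u + fe u else c u - fe u)%R.
have [a La a_notin] := card_eq_notin
  (t := [seq g u | u <- enum [set u in F | adj v u]%SET]) (LH v)
  ltac:(by rewrite size_map -cardE ltnS).
have feE (e : edge H) u : val e = [set v; u]%SET -> fe u = f e.
  by rewrite /fe => <-; rewrite valK.
have gP u : u \in F -> adj v u -> g u <> a.
  move=> uF vu ga; case/negP: a_notin; rewrite -ga; apply: map_f.
  by rewrite mem_enum finset.inE uF.
exists (fun u => if u == v then a else c u); split=> [w|e x y].
  by have [->//|wv wF] := eqVneq w v; apply: cL; rewrite !finset.inE wv.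
have [->|xv] := eqVneq x v; have [->|yv] := eqVneq y v => xF yF.
- by move=> _ /Dadj; rewrite adj_irr.
- move=> ve dvy h; apply: (gP y yF (Dadj _ _ dvy)).
  by rewrite /g dvy (feE e) // -h GRing.addrC GRing.subrK.
- move=> ve dxv h; have xv' := Dadj _ _ dxv.
  apply: (gP x xF); first by rewrite adj_sym.
  have := Dasym _ _ xv'; rewrite dxv /g => /negbTE ->.
  by rewrite (feE e) ?ve 1?finset.setUC // -h GRing.opprB GRing.addrC GRing.subrK.
- by apply: cf; rewrite !finset.inE ?xv ?yv.
Qed.

Lemma chi_gl_le k (H : sgraph) : group_choosable k H -> chi_gl H <= k.
Proof. by rewrite /chi_gl; case: ex_minnP => m _ hm /asboolP; apply: hm. Qed.

(** * Subdivisions as systems of internally disjoint paths *)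

Lemma series_parallel_sub (G G' : sgraph) :
  subgraph_of G' G -> series_parallel G -> series_parallel G'.
Proof.
move=> [g [gI gadj]] spG [S [subS [h [hI hadj]]]]; apply: spG.
exists S; split=> //; exists (g \o h); split; first exact: inj_comp.
by move=> u v /hadj /gadj.
Qed.

Lemma path_infix2 (T : eqType) (e : rel T) x s u v :
  path e x s -> infix [:: u; v] (x :: s) -> e u v.
Proof.
move=> es /infixP [s1 [s2 E]].
have : sorted e (x :: s) by [].
by rewrite E => /cat_sorted2 [_] /= /andP [].
Qed.

Lemma path_adj_rev (G : sgraph) (u v : G) q :
  path (@adj G) u (rcons q v) -> path (@adj G) v (rcons (rev q) u).
Proof.
move=> h; rewrite -rev_cons -(belast_rcons u q v) -[X in path _ X](last_rcons u q v).
rewrite rev_path (eq_path (e' := @adj G)) // => s t; exact: adj_sym.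
Qed.

Section Realize.
Variables (H G : sgraph) (b : H -> G) (p : H -> H -> seq G).
Hypothesis b_inj : injective b.
Hypothesis p_path : forall x y : H, adj x y ->
  [/\ path (@adj G) (b x) (rcons (p x y) (b y)), uniq (p x y),
      (forall z : H, b z \notin p x y) & p y x = rev (p x y)].
Hypothesis p_disj : forall (x y x' y' : H) (w : G), adj x y -> adj x' y' ->
  w \in p x y -> w \in p x' y' -> [set x; y]%SET = [set x'; y']%SET.

(** The subdivision itself lives on the vertices that occur in the path system
    and keeps only the edges run through by one of the paths; other edges of [G]
    between these vertices are dropped. *)
Definition used : pred G := fun w =>
  [exists x, w == b x] || [exists x, exists y, adj x y && (w \in p x y)].

Definition trail_adj : rel {w | used w} := fun u v =>
  [exists x, exists y, adj x y &&
     infix [:: val u; val v] (b x :: rcons (p x y) (b y))].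

Lemma trail_adjP u v : reflect
  (exists x y, adj x y /\ infix [:: val u; val v] (b x :: rcons (p x y) (b y)))
  (trail_adj u v).
Proof.
apply: (iffP existsP) => [[x /existsP [y /andP [xy i]]]|[x [y [xy i]]]].
  by exists x, y.
by exists x; apply/existsP; exists y; rewrite xy.
Qed.

Lemma trail_adj_sub u v : trail_adj u v -> adj (val u) (val v).
Proof.
by case/trail_adjP=> x [y [/p_path [pxy _ _ _]]]; apply: path_infix2.
Qed.

Lemma trail_adj_sym : symmetric trail_adj.
Proof.
suff h u v : trail_adj u v -> trail_adj v u by move=> u v; apply/idP/idP; apply: h.
case/trail_adjP=> x [y [xy i]]; apply/trail_adjP; exists y, x.
split; first by rewrite adj_sym.
have [_ _ _ ->] := p_path xy.
have -> : b y :: rcons (rev (p x y)) (b x) = rev (b x :: rcons (p x y) (b y)).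
  by rewrite rev_cons rev_rcons.
by rewrite -(infix_rev [:: val u; val v]) in i.
Qed.

Lemma trail_adj_irr : irreflexive trail_adj.
Proof. by move=> u; apply: contraFF (@trail_adj_sub u u) (adj_irr (val u)). Qed.

(** Any system of internally disjoint paths of [G] that follows the pattern of
    [H] is a subdivision of [H] inside [G], so that one may exhibit paths in [G]
    instead of building the graph. *)
Lemma realize_subdivision :
  exists S : sgraph, is_subdivision H S /\ subgraph_of S G.
Proof.
pose S := SGraph trail_adj_sym trail_adj_irr.
exists S; split; last first.
  by exists val; split; [exact: val_inj | exact: trail_adj_sub].
have used_b x : used (b x) by rewrite /used; apply/orP; left; apply/existsP; exists x.
pose b' x : S := Sub (b x) (used_b x).
pose p' x y : seq S := pmap insub (p x y).
have p'E x y : adj x y -> map val (p' x y) = p x y.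
  move=> xy; rewrite /p' (pmap_filter (insubK _)); apply/all_filterP/allP => w wp.
  rewrite insubT //; apply/orP; right; apply/existsP; exists x.
  by apply/existsP; exists y; rewrite xy.
have mem_p' x y w : adj x y -> (w \in p' x y) = (val w \in p x y).
  by move=> xy; rewrite -(p'E x y xy) (mem_map val_inj).
have trailE x y : adj x y -> map val (b' x :: rcons (p' x y) (b' y))
    = b x :: rcons (p x y) (b y).
  by move=> xy /=; rewrite map_rcons p'E.
exists b', p'; split.
- by move=> x y /(congr1 val) /b_inj.
- move=> x y xy; have [pxy up bp rp] := p_path xy; split.
  + have h (q : seq S) u : (forall v w, infix [:: v; w] (u :: q) -> adj v w) ->
        path (@adj S) u q.
      elim: q u => [//|v q IH u hq]; rewrite [path _ _ _]/=; apply/andP; split.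
        by apply: hq; exact: (prefix_infix [:: u; v]).
      by apply: IH => v1 v2 i; apply: hq; apply: infix_trans i (infix_cons _ _).
    apply: h => v w i; apply/trail_adjP; exists x, y; split=> //.
    rewrite -trailE //; case/infixP: i => s1 [s2 ->].
    by apply/infixP; exists (map val s1), (map val s2); rewrite !map_cat.
  + by rewrite -(map_inj_uniq val_inj) p'E.
  + by move=> z; rewrite mem_p' //; apply: bp.
  + apply: (inj_map (val_inj (sT := {w | used w}))); rewrite map_rev !p'E ?rp //.
    by rewrite adj_sym.
- move=> x y x' y' w xy xy'; rewrite !mem_p' //; exact: p_disj.
- move=> w; case/orP: (valP w) => [/existsP [x /eqP wx]|].
    by left; exists x; apply: val_inj.
  case/existsP => x /existsP [y /andP [xy wp]].
  by right; exists x, y; rewrite mem_p'.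
- move=> u v /trail_adjP [x [y [xy i]]]; exists x, y; split=> //.
  case/infixP: i => s1 [s2]; rewrite -trailE // => E.
  set q := _ :: rcons _ _ in E *.
  apply/infixP; exists (take (size s1) q), (drop (2 + size s1) q).
  apply: (inj_map (val_inj (sT := {w | used w}))); rewrite !map_cat map_take map_drop E.
  by rewrite take_size_cat // -drop_drop drop_size_cat //= drop0.
Qed.
End Realize.

(** The inner vertices of the paths of a subdivided [K_4] in which the three edges
    at 0 2, 0 3 and 1 2 are left undivided. *)
Definition K4_inner (T : eqType) (X Y Z : seq T) (x y : nat) : seq T :=
  match x, y with
  | 0, 1 => X | 1, 0 => rev X
  | 2, 3 => Y | 3, 2 => rev Y
  | 1, 3 => Z | 3, 1 => rev Z
  | _, _ => [::]
  end.

(** The shape of subdivided [K_4] that longest paths produce: [X], [Y], [Z] are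
    the inner vertices of the connections a-d, c-e and d-e. *)
Lemma K4_subdivision (G : sgraph) (a d c e : G) (X Y Z : seq G) :
  path (@adj G) a (rcons X d) -> path (@adj G) c (rcons Y e) ->
  path (@adj G) d (rcons Z e) -> adj a c -> adj a e -> adj c d ->
  uniq ([:: a; d; c; e] ++ (X ++ Y ++ Z)) -> ~ series_parallel G.
Proof.
move=> pX pY pZ ac ae cd; rewrite cat_uniq => /and3P [ub nb ui].
apply; pose b (x : 'I_4) : G := nth a [:: a; d; c; e] x.
pose p (x y : 'I_4) := K4_inner X Y Z x y.
have bE x : b x \in [:: a; d; c; e] by apply: mem_nth; case: x.
have pS x y w : w \in p x y -> w \in X ++ Y ++ Z.
  rewrite !mem_cat /p /K4_inner.
  by case: x y => [[|[|[|[|[]]]]] //= _] [[|[|[|[|[]]]]] //= _];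
     rewrite ?in_nil ?mem_rev // => ->; rewrite ?orbT.
have {}nb w : w \in X ++ Y ++ Z -> w \notin [:: a; d; c; e].
  by move=> wi; apply: contraNN nb => wb; apply/hasP; exists w.
have [uX uYZ nXYZ] : [/\ uniq X, uniq (Y ++ Z) & ~~ has (mem X) (Y ++ Z)].
  by move: ui; rewrite cat_uniq => /and3P [].
have [uY uZ nYZ] : [/\ uniq Y, uniq Z & ~~ has (mem Y) Z].
  by move: uYZ; rewrite cat_uniq => /and3P [].
have XY w : w \in X -> w \in Y -> False.
  by move=> wX wY; case/hasP: nXYZ; exists w; rewrite // mem_cat wY.
have XZ w : w \in X -> w \in Z -> False.
  by move=> wX wZ; case/hasP: nXYZ; exists w; rewrite // mem_cat wZ orbT.
have YZ w : w \in Y -> w \in Z -> False.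
  by move=> wY wZ; case/hasP: nYZ; exists w.
apply: (@realize_subdivision (complete_graph 4) G b p).
- by move=> x y /eqP; rewrite nth_uniq // => /eqP /val_inj.
- move=> x y xy; split.
  + move: xy; rewrite /b /p /K4_inner.
    by case: x y => [[|[|[|[|[]]]]] //= hx] [[|[|[|[|[]]]]] //= hy] => // _;
       rewrite ?(ac, ae, cd, adj_sym c a, adj_sym e a, adj_sym d c) //;
       apply: path_adj_rev.
  + rewrite /p /K4_inner.
    by case: x y {xy} => [[|[|[|[|[]]]]] //= _] [[|[|[|[|[]]]]] //= _];
      rewrite ?rev_uniq.
  + by move=> z; apply/negP => /pS /nb; rewrite bE.
  + rewrite /p /K4_inner.
    by case: x y {xy} => [[|[|[|[|[]]]]] //= _] [[|[|[|[|[]]]]] //= _];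
      rewrite ?revK.
pose i0 : 'I_4 := Ordinal (isT : 0 < 4); pose i1 : 'I_4 := Ordinal (isT : 1 < 4).
pose i2 : 'I_4 := Ordinal (isT : 2 < 4); pose i3 : 'I_4 := Ordinal (isT : 3 < 4).
have pP x y w : w \in p x y ->
    [\/ w \in X /\ [set x; y]%SET = [set i0; i1]%SET,
        w \in Y /\ [set x; y]%SET = [set i2; i3]%SET |
        w \in Z /\ [set x; y]%SET = [set i1; i3]%SET].
  have oE (k : nat) (h h' : k < 4) : Ordinal h = Ordinal h' by apply: val_inj.
  rewrite /p /K4_inner.
  case: x y => [[|[|[|[|[]]]]] //= hx] [[|[|[|[|[]]]]] //= hy];
    rewrite ?in_nil ?mem_rev // => wp; rewrite (oE _ hx isT) (oE _ hy isT);
    by [constructor 1; rewrite // finset.setUC | constructor 2; rewrite // finset.setUC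
      | constructor 3; rewrite // finset.setUC
      | constructor 1 | constructor 2 | constructor 3].
move=> x y x' y' w _ _ /pP h /pP h'.
by case: h h' => [[w1 ->]|[w1 ->]|[w1 ->]] [[w2 ->]|[w2 ->]|[w2 ->]] //;
  exfalso; eauto.
Qed.

(** * Dirac's theorem *)

Lemma perm_branch (T : eqType) (a d c x : T) (A B Z Z' : seq T) :
  perm_eq Z Z' ->
  perm_eq ([:: a; d; c; x] ++ (A ++ B ++ Z)) (a :: A ++ d :: c :: B ++ x :: Z').
Proof.
move=> /permP ZZ'; apply/permP => P.
rewrite /= !count_cat /= !count_cat /= ZZ'.
move: (count P A) (count P B) (count P Z') => *.
by move: (nat_of_bool (P a)) (nat_of_bool (P d)) (nat_of_bool (P c)) (nat_of_bool (P x)) => *; lia.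
Qed.

Lemma perm_swap_ends (T : eqType) (a d : T) (A s : seq T) :
  perm_eq (d :: rev A ++ a :: s) (a :: A ++ d :: s).
Proof.
apply/permP => P; rewrite /= !count_cat /= count_rev.
by move: (count P A) (count P s) (nat_of_bool (P a)) (nat_of_bool (P d)) => *; lia.
Qed.

(** The crossing configuration: two chords from [a] and one from [d], where [y]
    does not precede [x] on the path.  The missing connection d-x is the chord
    from [d] to [y], followed by the path backwards from [y] to [x]. *)
Lemma path_config_K4 (G : sgraph) (a c d x y : G) (A B1 B2 : seq G) :
  uniq (a :: A ++ d :: c :: B1 ++ x :: B2) ->
  path (@adj G) a (A ++ d :: c :: B1 ++ x :: B2) ->
  adj a c -> adj a x -> adj d y -> y \in x :: B2 -> ~ series_parallel G.
Proof.
move=> uP; rewrite cat_path /= cat_path /= => /and5P [pA Ad dc pB /andP [Bx pB2]] ac ax dy.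
have pAd : path (@adj G) a (rcons A d) by rewrite rcons_path pA.
have pBx : path (@adj G) c (rcons B1 x) by rewrite rcons_path pB.
rewrite inE; case: eqP dy => [-> dx _|_ dy /= yB].
  refine (K4_subdivision (Z := [::]) pAd pBx _ ac ax _ _).
  - by rewrite /= dx.
  - by rewrite adj_sym.
  rewrite (perm_uniq (perm_branch a d c x A B1 (perm_refl [::]))).
  have E : a :: A ++ d :: c :: B1 ++ x :: B2
      = (a :: A ++ d :: c :: B1 ++ [:: x]) ++ B2 by rewrite /= -catA /= -catA.
  by move: uP; rewrite E cat_uniq => /andP [].
case/splitPr: yB uP pB2 => C1 C2 uP; rewrite cat_path /= => /and3P [pC1 C1y _].
refine (K4_subdivision (Z := y :: rev C1) pAd pBx _ ac ax _ _).
- by rewrite /= dy; apply: path_adj_rev; rewrite rcons_path pC1.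
- by rewrite adj_sym.
have yC : perm_eq (y :: rev C1) (C1 ++ [:: y]).
  by rewrite -rev_rcons perm_rev cats1.
rewrite (perm_uniq (perm_branch a d c x A B1 yC)).
have E : a :: A ++ d :: c :: B1 ++ x :: C1 ++ y :: C2
    = (a :: A ++ d :: c :: B1 ++ x :: C1 ++ [:: y]) ++ C2.
  by rewrite /= -catA /= -catA /= -catA.
by move: uP; rewrite E cat_uniq => /andP [].
Qed.

Section Dirac.
Variable G : sgraph.
Hypothesis deg3 : forall x y : G, adj x y -> 3 <= degree x.

Lemma third_neighbour (x y z1 z2 : G) :
  adj x y -> exists w, [/\ adj x w, w != z1 & w != z2].
Proof.
move=> /deg3; case: (boolP [exists w, [&& adj x w, w != z1 & w != z2]]).
  by move=> /existsP [w /and3P [? ? ?]] _; exists w.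
move=> /existsPn nw; rewrite leqNgt ltnS /degree => /negP [].
apply: leq_trans (card_size [:: z1; z2]).
apply/subset_leq_card/fintype.subsetP => w; rewrite !inE => xw.
by have := nw w; rewrite xw -negb_or negbK.
Qed.

Variable m : nat.
Hypothesis longest :
  forall (x : G) s, uniq (x :: s) -> path (@adj G) x s -> size s <= m.

(** A neighbour off the path would extend it. *)
Lemma end_neighbour (x y : G) s :
  uniq (x :: s) -> path (@adj G) x s -> size s = m -> adj x y -> y \in s.
Proof.
move=> us ps sm xy; apply/negPn/negP => ys.
have : size (x :: s) <= m.
  apply: (@longest y); last by rewrite /= adj_sym xy.
  rewrite cons_uniq us andbT inE (negbTE ys) orbF.
  by apply: contraTneq xy => ->; rewrite adj_irr.
by rewrite /= sm ltnn.
Qed.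

(** Longest paths [A ++ c :: B] with a chord from the first vertex of [A] to [c];
    the chord makes [rev A ++ c :: B] a path too.  As [A] is not empty, the
    default value of [head] is never reached. *)
Definition rotatable (A : seq G) (c : G) (B : seq G) : Prop :=
  [/\ 1 < size A, uniq (A ++ c :: B), sorted (@adj G) (A ++ c :: B),
      size (A ++ c :: B) = m.+1 & adj (head c A) c].

(** The chord and the path edge from the last vertex of [A] to [c] exchange
    their roles. *)
Lemma rotatable_rev A c B : rotatable A c B -> rotatable (rev A) c B.
Proof.
case: A => [|a A] [] // sA uA pA mA ac; split.
- by rewrite size_rev.
- by rewrite (perm_uniq (s2 := (a :: A) ++ c :: B)) // perm_cat2r perm_rev.
- move: pA; rewrite /= cat_path /= => /and3P [pA Ac pB].
  rewrite lastI rev_rcons /= cat_path /= pB rev_path.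
  rewrite (eq_path (e' := @adj G)) ?pA; last by move=> s t; exact: adj_sym.
  by case: (A) ac => [|h T] /= ac; rewrite ?rev_cons ?last_rcons ac.
- by rewrite size_cat size_rev -size_cat.
- by move: pA; rewrite lastI rev_rcons -lastI /= cat_path => /and3P [].
Qed.

(** Induction on the size of [A] stands for the choice of a shortest [A]: a chord
    from an end of [A] back into [A] yields a rotatable path with a shorter
    initial part. *)
Lemma rotatable_K4 A c B : rotatable A c B -> ~ series_parallel G.
Proof.
have [n] := ubnP (size A); elim: n A c B => // n IH A c B; rewrite ltnS => sAn rA spG.
(* Stated for [A1] of the size of [A], to apply to [A] and to its reversal. *)
have far A1 : rotatable A1 c B -> size A1 = size A ->
    exists2 x, x \in B & adj (head c A1) x.
  case: A1 => [|a [|h T]] [] //= sA uA pA mA ac szA.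
  have [w [aw wh wc]] := third_neighbour h c ac.
  have := end_neighbour uA pA (eq_add_S _ _ mA) aw.
  rewrite inE (negbTE wh) /= mem_cat inE (negbTE wc) /= => /orP [wT|wB]; last by exists w.
  exfalso; case/splitPr: wT uA pA mA szA => T1 T2 uA pA mA szA.
  apply: (IH (a :: h :: T1) w (T2 ++ c :: B)) => //.
    by apply: leq_trans sAn; rewrite -szA /= size_cat /= addnS !ltnS leq_addr.
  have E : (a :: h :: T1) ++ w :: T2 ++ c :: B = a :: h :: (T1 ++ w :: T2) ++ c :: B.
    by rewrite /= -catA.
  by split; rewrite ?E.
have [x xB ax] := far A rA erefl.
have [y yB dy] := far _ (rotatable_rev rA) (size_rev A).
case: rA; case: A {IH sAn far} ax dy => [|a A] //; case/lastP: A => [|A d] //.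
rewrite -rcons_cons rev_rcons /= cat_rcons => ax dy _ uA pA _ ac.
have dc : adj d c by move: pA; rewrite cat_path /= => /and4P [].
have swap : uniq (d :: rev A ++ a :: c :: B) /\ path (@adj G) d (rev A ++ a :: c :: B).
  split.
    by rewrite (perm_uniq (perm_swap_ends _ _ _ _)).
  move: pA; rewrite -cat_rcons cat_path last_rcons => /andP [pA /= /andP [_ pB]].
  by rewrite -cat_rcons cat_path last_rcons /= ac pB !andbT path_adj_rev.
case/splitPr: xB yB uA pA swap => B1 B2; rewrite mem_cat => /orP [yB|yB] uA pA.
  case/splitPr: yB uA pA => C1 C2 _ _ [uS pS]; rewrite -catA /= in uS pS.
  by apply: (path_config_K4 uS pS dc dy ax) spG; rewrite inE mem_cat mem_head !orbT.
by move=> _; exact: (path_config_K4 uA pA ac ax dy yB).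
Qed.
End Dirac.

(** A third neighbour of the first vertex of a longest path is not its successor,
    hence it is the end of a chord that makes the path rotatable.  Isolated
    vertices are allowed because spanning subgraphs have them. *)
Lemma dirac_K4_subdivision (G : sgraph) (x0 y0 : G) :
  adj x0 y0 -> (forall x y : G, adj x y -> 3 <= degree x) -> ~ series_parallel G.
Proof.
move=> xy0 deg3.
pose P n := `[< exists (x : G) s,
  [/\ uniq (x :: s), path (@adj G) x s & size s = n] >].
have P1 : P 1.
  apply/asboolP; exists x0, [:: y0]; rewrite /= xy0 inE andbT; split=> //.
  by apply: contraTneq xy0 => ->; rewrite adj_irr.
have Pbound n : P n -> n <= #|G|.
  move=> /asboolP [x [s [/andP [_ us] _ <-]]]; rewrite -(card_uniqP us); exact: max_card.
case: (ex_maxnP (ex_intro P 1 P1) Pbound) => m /asboolP [x [s [us ps sm]]] maxm.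
have longest (z : G) t : uniq (z :: t) -> path (@adj G) z t -> size t <= m.
  by move=> ut pt; apply: maxm; apply/asboolP; exists z, t.
have m1 := maxm _ P1.
case: s us ps sm => [|h s] us ps sm; first by rewrite -sm in m1.
have xh : adj x h by case/andP: ps.
have [w [xw wh _]] := third_neighbour deg3 h h xh.
have := end_neighbour longest us ps sm xw; rewrite inE (negbTE wh) /= => ws.
case/splitPr: ws us ps sm => s1 s2 us ps sm.
apply: (rotatable_K4 deg3 longest (A := x :: h :: s1) (c := w) (B := s2)).
by split=> //=; congr S.
Qed.

(** * Line graphs of series-parallel graphs *)

Section EdgeSubgraph.
Variables (G : sgraph) (F : {set edge G}).

Definition span_adj : rel G := fun x y => [exists e in F, val e == [set x; y]%SET].

Lemma span_adj_sub x y : span_adj x y -> adj x y.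
Proof.
case/existsP => e /andP [_ /eqP exy].
have /existsP [u /existsP [v /andP [uv /eqP euv]]] := valP e.
have : (u \in [set x; y])%SET && (v \in [set x; y])%SET.
  by rewrite -exy euv !finset.inE !eqxx orbT.
have : (x \in [set u; v])%SET && (y \in [set u; v])%SET.
  by rewrite -euv exy !finset.inE !eqxx orbT.
rewrite !finset.inE => /andP [xuv yuv] /andP [uxy vxy].
have neq : u != v by apply: contraTneq uv => ->; rewrite adj_irr.
case/orP: uxy vxy neq => /eqP uE /orP [] /eqP vE; subst u v; rewrite ?eqxx //.
by rewrite adj_sym.
Qed.

Lemma span_adj_sym : symmetric span_adj.
Proof. by move=> x y; apply: eq_existsb => e; rewrite finset.setUC. Qed.

Lemma span_adj_irr : irreflexive span_adj.
Proof. by move=> x; apply: contraFF (@span_adj_sub x x) (adj_irr x). Qed.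

Definition span : sgraph := SGraph span_adj_sym span_adj_irr.

Lemma span_subgraph : subgraph_of span G.
Proof. by exists id; split=> // x y; exact: span_adj_sub. Qed.

Lemma degree_span_le (x : G) : degree (x : span) <= degree x.
Proof. by apply/subset_leq_card/fintype.subsetP => w; exact: span_adj_sub. Qed.

Definition star (x : G) : {set edge G} := [set e in F | x \in val e]%SET.

Lemma card_star (x : G) : #|star x| <= degree (x : span).
Proof.
rewrite -(card_imset _ val_inj) /degree.
apply: leq_trans (leq_imset_card (fun w => [set x; w]%SET) _).
apply/subset_leq_card/fintype.subsetP => _ /finset.imsetP [e + ->].
rewrite finset.inE => /andP [eF xe].
have /existsP [u /existsP [v /andP [uv /eqP euv]]] := valP e.
have [w ew] : exists w, val e = [set x; w]%SET.
  move: xe; rewrite euv !finset.inE => /orP [] /eqP ->; first by exists v.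
  by exists u; rewrite finset.setUC.
apply/finset.imsetP; exists w => //.
by apply/existsP; exists e; rewrite eF ew eqxx.
Qed.
End EdgeSubgraph.

(** Dirac's theorem in the spanning subgraph with edge set [F] gives an edge [xy]
    in [F] with [x] of degree at most two there; it meets at most one other edge
    of [F] at [x], and at most [max_degree G - 1] at [y]. *)
Lemma line_graph_degenerate (G : sgraph) :
  series_parallel G -> degenerate (max_degree G) (line_graph G).
Proof.
move=> spG F /finset.set0Pn [e0 e0F].
have [x [y [xy degx]]] : exists x y, span_adj F x y /\ degree (x : span F) <= 2.
  apply: contrapT => nex.
  have /existsP [x0 /existsP [y0 /andP [_ /eqP e0E]]] := valP e0.
  have xy0 : @adj (span F) x0 y0 by apply/existsP; exists e0; rewrite e0F e0E eqxx.
  apply: (dirac_K4_subdivision xy0); last exact: series_parallel_sub (span_subgraph F) spG.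
  by move=> x y xy; rewrite leqNgt ltnS; apply/negP => degx; apply: nex; exists x, y.
have /existsP [e /andP [eF /eqP eE]] := xy.
exists e => //.
have xe : e \in star F x by rewrite finset.inE eF eE !finset.inE eqxx.
have ye : e \in star F y by rewrite finset.inE eF eE !finset.inE eqxx orbT.
have sub : ([set u in F | @adj (line_graph G) e u] \subset
    (star F x :\ e) :|: (star F y :\ e))%SET.
  apply/fintype.subsetP => u; rewrite !finset.inE => /andP [uF /andP [eu]].
  have ue : (u == e) = false by rewrite eq_sym; apply/negbTE.
  case/finset.set0Pn => w; rewrite eE !finset.inE uF ue /= => /andP [].
  by case/orP=> /eqP -> ->; rewrite ?orbT.
apply: leq_trans (subset_leq_card sub) _.
apply: (@leq_trans (#|star F x :\ e| + #|star F y :\ e|)%SET).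
  exact: leq_card_setU.
have := card_star F x; rewrite (cardsD1 e) xe => h1.
have := card_star F y; rewrite (cardsD1 e) ye => h2.
have := degree_span_le F y; have : degree y <= max_degree G by exact: leq_bigmax.
lia.
Qed.

(** * From subdivisions to minors *)

Lemma connect_along (T : finType) (e : rel T) (P : pred T) x s w :
  path e x s -> {subset x :: s <= P} -> w \in x :: s ->
  connect [rel u v | [&& P u, P v & e u v]] x w.
Proof.
elim: s x => [|y s IH] x /= => [_ _|/andP [xy ys] sP]; first by rewrite inE => /eqP ->.
rewrite inE => /orP [/eqP -> //|wys].
apply: connect_trans (IH y ys _ wys); last by move=> z zs; apply: sP; rewrite inE zs orbT.
by apply: connect1; rewrite /= xy [P x]sP ?[P y]sP ?mem_head // inE mem_head orbT.
Qed.

(** Each branch vertex takes over the inner vertices of its paths to the branch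
    vertices of higher rank, so every path is absorbed by exactly one of its
    ends and its last edge joins the two branch sets. *)
Lemma subdivision_minor (H S G : sgraph) :
  is_subdivision H S -> subgraph_of S G -> is_minor H G.
Proof.
move=> [b [p [bI bP pD _ _]]] [g [gI gadj]].
pose own x (w : S) :=
  (w == b x) ||
  [exists y, [&& adj x y, enum_rank x < enum_rank y & w \in p x y]].
have own_b x : own x (b x) by rewrite /own eqxx.
have own_p x y w : adj x y -> enum_rank x < enum_rank y -> w \in p x y -> own x w.
  by move=> xy lt wp; apply/orP; right; apply/existsP; exists y; rewrite xy lt.
exists (fun x => [set g w | w in own x]%SET); split.
- move=> x; set B := imset _ _.
  have BE w : (g w \in B) = own x w by rewrite mem_imset.
  split; first by apply/finset.set0Pn; exists (g (b x)); rewrite BE.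
  have from_b v : v \in B ->
      connect [rel s t : G | [&& s \in B, t \in B & adj s t]] (g (b x)) v.
    case/finset.imsetP => w ow ->; case/orP: ow => [/eqP -> //|].
    case/existsP => y /and3P [xy lt wp].
    have [pxy _ _ _] := bP _ _ xy.
    apply: (@connect_along _ (@adj G) (mem B) _ (map g (p x y))).
    + move: pxy; rewrite rcons_path => /andP [pxy _].
      by apply: (homo_path (e := @adj S) _ pxy) => s t; apply: gadj.
    + move=> _ /(mapP (s := b x :: p x y)) [u ub ->].
      suff ou : own x u by rewrite inE BE.
      by move: ub; rewrite inE => /orP [/eqP -> //|]; exact: own_p.
    + by rewrite inE map_f ?orbT.
  move=> u v uB vB; apply: connect_trans (from_b v vB).
  rewrite sym_connect_sym; first exact: from_b.
  by move=> s t /=; rewrite andbCA adj_sym.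
- move=> x y xy; rewrite disjoint_subset; apply/fintype.subsetP => _ /finset.imsetP [w ox ->].
  rewrite inE /=; apply/negP => /finset.imsetP [w' oy /gI ww]; rewrite -{w'}ww in oy.
  case/orP: ox => [/eqP wx|/existsP [z /and3P [xz ltxz wz]]].
    case/orP: oy => [/eqP|/existsP [z /and3P [yz _]]]; rewrite wx.
      by move/bI => E; rewrite E eqxx in xy.
    by have [_ _ /(_ x) /negbTE -> _] := bP _ _ yz.
  case/orP: oy => [/eqP wy|/existsP [z' /and3P [yz ltyz wz']]].
    by have [_ _ /(_ y) + _] := bP _ _ xz; rewrite -wy wz.
  have E := pD _ _ _ _ _ xz yz wz wz'.
  have : (x \in [set y; z'])%SET by rewrite -E !finset.inE eqxx.
  have : (y \in [set x; z])%SET by rewrite E !finset.inE eqxx.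
  rewrite !finset.inE (negbTE xy) eq_sym (negbTE xy) /= => /eqP yz' /eqP xz'.
  by move: ltxz ltyz; rewrite -yz' -xz' => /ltn_trans h /h; rewrite ltnn.
- have half x y : adj x y -> enum_rank x < enum_rank y ->
      exists u v, [/\ u \in [set g w | w in own x]%SET,
        v \in [set g w | w in own y]%SET & adj u v].
    move=> xy lt; exists (g (last (b x) (p x y))), (g (b y)).
    split.
    + apply: finset.imset_f; suff: own x (last (b x) (p x y)) by [].
      have := mem_last (b x) (p x y); rewrite inE.
      by case/orP => [/eqP -> //|]; exact: own_p.
    + by apply: finset.imset_f; exact: own_b.
    + by apply: gadj; have [+ _ _ _] := bP _ _ xy; rewrite rcons_path => /andP [].
  move=> x y xy; case: (ltngtP (enum_rank x) (enum_rank y)) => [|lt|/val_inj/enum_rank_inj E].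
  + exact: half.
  + have [|u [v [uB vB uv]]] := half y x _ lt; first by rewrite adj_sym.
    by exists v, u; rewrite adj_sym.
  + by rewrite E adj_irr in xy.
Qed.

Theorem corollary4p3 (G : sgraph) :
  (series_parallel G -> chi'_gl G <= (max_degree G).+1) /\
  (K4_minor_free G -> edge_group_choosable (max_degree G).+1 G).
Proof.
have choosable : series_parallel G -> edge_group_choosable (max_degree G).+1 G.
  by move=> spG; apply/degenerate_group_choosable/line_graph_degenerate.
split=> [/choosable|nominor]; first exact: chi_gl_le.
by apply: choosable => -[S [subS SG]]; apply: nominor; exact: subdivision_minor SG.
Qed.
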